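(* The following two statements are equivalent: (a) There exists a group that is not w-sofic. (b) There exist a finitely generated free group $F$ and a finite sequence $g_1,g_2,\dots,g_k\in F$ such that $$\overline{[g_1]^F[g_2]^F\cdots[g_k]^F}\not\subseteq N(g_1,g_2,\dots,g_k),$$ where the bar denotes closure in the profinite topology on $F$ and $N(g_1,\dots,g_k)$ is the normal subgroup of $F$ generated by $g_1,\dots,g_k$.
   Context: Notation: for a group $G$, $e_G$ is its unit element; for $g\in G$, $[g]^G$ is the conjugacy class of $g$ in $G$; for $A,B\subseteq G$, $AB=\{xy : x\in A,\ y\in B\}$. Profinite topology: the topology on $F$ in which the normal subgroups of finite index form a base of neighborhoods of the unit element. For $X\subseteq F$, $\overline{X}$ denotes the closure of $X$ in this topology. $(\Phi,\epsilon,\alpha)$-homomorphism: Let $H$ be a finite group with a bi-invariant metric $d$ (i.e. $d(xa,xb)=d(a,b)=d(ax,bx)$ for all $a,b,x\in H$; the metric is not required to be normalized). Let $G$ be a group, $\Phi\subseteq G$ a finite subset, $\epsilon>0$, $\alpha>0$. A map $\phi:\Phi\to H$ is a $(\Phi,\epsilon,\alpha)$-homomorphism if: (1) for any $a,b\in\Phi$ with $ab\in\Phi$, $d(\phi(a)\phi(b),\phi(ab))<\epsilon$; (2) if $e_G\in\Phi$ then $\phi(e_G)=e_H$; (3) for any $a\in\Phi$ with $a\neq e_G$, $d(\phi(a),e_H)>\alpha$. w-sofic: A group $G$ is w-sofic if there exists $\alpha>0$ such that for any finite set $\Phi\subset G$ and any $\epsilon>0$ there exist a finite group $H$ with a bi-invariant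 metric $d$ and a $(\Phi,\epsilon,\alpha)$-homomorphism from $\Phi$ to $(H,d)$. *)

(* Defs.v *)
From HB Require Import structures.
From mathcomp Require Import all_boot all_order all_algebra fingroup.
From mathcomp Require Import mathcomp_extra boolp classical_sets functions.
From mathcomp Require Import cardinality filter reals topology.
Set Implicit Arguments.
Unset Strict Implicit.
Unset Printing Implicit Defensive.
Import Order.TTheory GRing.Theory Num.Theory.
Local Open Scope classical_set_scope.
Local Open Scope group_scope.

Section Subgroups.
Variable G : groupType.
Implicit Types K A B : set G.

Definition subgroup K : Prop :=
  [/\ K 1, forall x y, K x -> K y -> K (x * y) & forall x, K x -> K x^-1].

Definition normal_subgroup K : Prop :=
  subgroup K /\ forall x y, K x -> K (x ^ y).

Definition finite_index K : Prop := finite_set [set mul x @` K | x in setT].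

Definition conj_class (g : G) : set G := [set g ^ x | x in setT].

Definition set_mul A B : set G := [set x * y | x in A & y in B].

Definition class_prod (gs : seq G) : set G :=
  foldr set_mul [set 1] [seq conj_class g | g <- gs].

Definition normal_closure A : set G := smallest normal_subgroup A.

Definition finitely_generated : Prop :=
  exists s : seq G, smallest subgroup [set` s] = setT.

(* Only the restriction of [f] to [X] matters. *)
Definition free_basis (X : set G) : Prop :=
  forall (H : groupType) (f : G -> H),
  exists h : UMagmaMorphism.type G H,
    (forall x, X x -> h x = f x) /\
    (forall h' : UMagmaMorphism.type G H,
       (forall x, X x -> h' x = f x) -> h' =1 h).

Definition free_group : Prop := exists X : set G, free_basis X.

End Subgroups.
Arguments finitely_generated : clear implicits.
Arguments free_group : clear implicits.

Section ProfiniteFilter.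
Variable G : groupType.
Implicit Types K L A : set G.

Definition normal_finite_index K : Prop := normal_subgroup K /\ finite_index K.

Lemma normal_finite_indexT : normal_finite_index [set: G].
Proof.
split; first by split=> //; split.
apply: (@sub_finite_set _ _ [set [set: G]]); last exact: finite_set1.
move=> _ [x _ <-]; apply/seteqP; split=> // y _.
by exists (x^-1 * y) => //; rewrite mulKVg.
Qed.

Lemma coset_setI K L (x : G) :
  mul x @` (K `&` L) = (mul x @` K) `&` (mul x @` L).
Proof.
apply/seteqP; split=> [_ [y [Ky Ly] <-]|z [[y Ky <-] [w Lw /mulgI wy]]].
  by split; exists y.
by exists y; split=> //; rewrite -wy.
Qed.

Lemma normal_finite_indexI K L : normal_finite_index K ->
  normal_finite_index L -> normal_finite_index (K `&` L).
Proof.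
move=> [[[K1 KM KV] KJ] Kf] [[[L1 LM LV] LJ] Lf]; split.
  split; last by move=> x y [Kx Lx]; split; [exact: KJ|exact: LJ].
  split=> // [x y [Kx Lx] [Ky Ly]|x [Kx Lx]].
    by split; [exact: KM|exact: LM].
  by split; [exact: KV|exact: LV].
have KLf := finite_setX Kf Lf.
apply: sub_finite_set (finite_image (fun p => p.1 `&` p.2) KLf).
move=> _ [x _ <-]; exists (mul x @` K, mul x @` L).
  by split; exists x.
by rewrite coset_setI.
Qed.

Definition profinite_nbhs (x : G) : set_system G :=
  filter_from normal_finite_index (fun K => mul x @` K).

Lemma profinite_nbhs_filter x : ProperFilter (profinite_nbhs x).
Proof.
apply: filter_from_proper.
  apply: filter_from_filter; first by exists setT; exact: normal_finite_indexT.
  move=> K L nK nL; exists (K `&` L); first exact: normal_finite_indexI.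
  by rewrite coset_setI.
by move=> K [[[K1 _ _] _] _]; exists (x * 1), 1.
Qed.

Lemma profinite_nbhs_singleton x A : profinite_nbhs x A -> A x.
Proof.
by move=> [K [[[K1 _ _] _] _]]; apply; exists 1 => //; rewrite mulg1.
Qed.

Lemma profinite_nbhs_nbhs x A : profinite_nbhs x A ->
  profinite_nbhs x (profinite_nbhs^~ A).
Proof.
move=> [K nK KA]; exists K => // _ [y Ky <-]; exists K => //.
move=> _ [z Kz <-]; apply: KA; exists (y * z); last by rewrite mulgA.
by have [[[_ KM _] _] _] := nK; exact: KM.
Qed.

End ProfiniteFilter.

(* A copy of [G] carrying the profinite topology; the neighbourhood base at
   [x] is the translate by [x] of the base at the unit. *)
Definition profinite (G : groupType) : Type := G.

HB.instance Definition _ (G : groupType) := Choice.on (profinite G).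
HB.instance Definition _ (G : groupType) :=
  hasNbhs.Build (profinite G) (@profinite_nbhs G).
HB.instance Definition _ (G : groupType) :=
  Nbhs_isNbhsTopological.Build (profinite G) (@profinite_nbhs_filter G)
    (@profinite_nbhs_singleton G) (@profinite_nbhs_nbhs G).

Definition profinite_closure (G : groupType) (A : set G) : set G :=
  closure (A : set (profinite G)).

Section WSofic.
Variable R : realType.
Local Open Scope ring_scope.

(* Nonnegativity of [d] follows from these axioms. *)
Record bi_invariant_metric (H : finGroupType) (d : H -> H -> R) : Prop := {
  bim_xx : forall x, d x x = 0 ;
  bim_positivity : forall x y, d x y = 0 -> x = y ;
  bim_sym : forall x y, d x y = d y x ;
  bim_triangle : forall x y z, d x z <= d x y + d y z ;
  bim_invl : forall x a b, d (x * a)%g (x * b)%g = d a b ;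
  bim_invr : forall x a b, d (a * x)%g (b * x)%g = d a b }.

(* A map [Phi -> H] is represented by a total map of which only the values on
   [Phi] are constrained. *)
Record approx_hom (G : groupType) (H : finGroupType) (d : H -> H -> R)
    (Phi : set G) (eps alpha : R) (phi : G -> H) : Prop := {
  approx_homM : forall a b, Phi a -> Phi b -> Phi (a * b)%g ->
    d (phi a * phi b)%g (phi (a * b)%g) < eps ;
  approx_hom1 : Phi 1%g -> phi 1%g = 1%g ;
  approx_hom_sep : forall a, Phi a -> a <> 1%g -> alpha < d (phi a) 1%g }.

Definition w_sofic (G : groupType) : Prop :=
  exists2 alpha : R, 0 < alpha &
  forall (Phi : set G) (eps : R), finite_set Phi -> 0 < eps ->
  exists (H : finGroupType) (d : H -> H -> R) (phi : G -> H),
    bi_invariant_metric d /\ approx_hom d Phi eps alpha phi.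

End WSofic.

(* Main.v *)
From HB Require Import structures.
Require Import Defs.
From mathcomp Require Import all_boot all_order all_algebra fingroup.
From mathcomp Require Import boolp classical_sets functions cardinality.
From mathcomp Require Import reals topology.
Set Implicit Arguments.
Unset Strict Implicit.
Unset Printing Implicit Defensive.
Import Order.TTheory GRing.Theory Num.Theory.
Local Open Scope classical_set_scope.
Local Open Scope group_scope.

(** Why the theorem is true.  In a finite group with a bi-invariant metric, a
    product of conjugates of elements close to 1 is close to 1, since
    conjugation preserves the distance to 1.  Conversely a conjugation-invariant
    set of elements becomes a small ball around 1 for the associated word metric,
    which is bi-invariant.  The closure of a product of conjugacy classes
    records exactly what survives of this in all the finite quotients of F.

    From (b) to (a) ([quotient_not_w_sofic]).  Let w lie in the closure of the
    class product of the g_i but not in their normal closure N.  If F / N were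
    w-sofic, an approximate homomorphism phi from F / N to H would give, by
    freeness, an honest homomorphism h from F to H that agrees with phi on the
    basis.  On any given element u of F, h u stays within a multiple of eps of the
    value of phi at the image of u ([tracked]).  Hence each h g_i is close to 1
    whereas h w is at distance about alpha.  But the kernel of h has finite
    index, so h w is a product of conjugates of the h g_i, hence close to 1: a
    contradiction once eps is small.

    From (a) to (b), by contraposition ([closed_class_prods_w_sofic]).  Let Phi
    be a finite part of G.  Take the free group F on Phi without 1, and as
    relators the multiplication table of Phi.  The evaluation from F to G kills
    the relators and sends the generator of a to a, so no generator is in the
    normal closure of the relators.  If (b) fails, none is then in the closure of
    a product of n conjugacy classes of relators or their inverses.  A single finite
    quotient H of F therefore sees that no generator is a product of n such
    conjugates.  For the word metric of H with respect to these conjugates,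
    truncated at n and scaled by eps / 2, the relators are eps-small and the
    generators are at distance n * eps / 2, which exceeds 1 when n is large. *)

(** * Quotients of groups and of word monoids *)

Local Open Scope quotient_scope.

(** Operations satisfying the group laws up to a congruence.  Both the quotient
    of a group by a normal subgroup and the free group, a quotient of a set of
    words, arise from this structure. *)
Record group_setoid (T : choiceType) := GroupSetoid {
  gs_mul : T -> T -> T;
  gs_one : T;
  gs_inv : T -> T;
  gs_rel : equiv_rel T;
  gs_relM : forall x x' y y', gs_rel x x' -> gs_rel y y' ->
    gs_rel (gs_mul x y) (gs_mul x' y');
  gs_relV : forall x x', gs_rel x x' -> gs_rel (gs_inv x) (gs_inv x');
  gs_mulA : forall x y z, gs_rel (gs_mul x (gs_mul y z)) (gs_mul (gs_mul x y) z);
  gs_mul1 : forall x, gs_rel (gs_mul gs_one x) x;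
  gs_mulr1 : forall x, gs_rel (gs_mul x gs_one) x;
  gs_mulV : forall x, gs_rel (gs_mul (gs_inv x) x) gs_one;
  gs_mulrV : forall x, gs_rel (gs_mul x (gs_inv x)) gs_one }.

Section QuotientGroup.
Variables (T : choiceType) (S : group_setoid T).

Definition quot_group := {eq_quot (gs_rel S)}.
HB.instance Definition _ := Choice.on quot_group.

Definition quot_pi (x : T) : quot_group := \pi_{eq_quot (gs_rel S)} x.

Lemma quot_piE x y : (quot_pi x = quot_pi y) <-> gs_rel S x y.
Proof. by split=> [/eqmodP|xy]; last exact/eqmodP. Qed.

Lemma quot_pi_surj (q : quot_group) : exists x, q = quot_pi x.
Proof. by exists (generic_quotient.repr q); rewrite /quot_pi reprK. Qed.

Definition quot_mul (p q : quot_group) : quot_group :=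
  quot_pi (gs_mul S (generic_quotient.repr p) (generic_quotient.repr q)).
Definition quot_inv (p : quot_group) : quot_group :=
  quot_pi (gs_inv S (generic_quotient.repr p)).

Lemma repr_quot_pi x : gs_rel S (generic_quotient.repr (quot_pi x)) x.
Proof. by apply/quot_piE; rewrite /quot_pi reprK. Qed.

Lemma quot_piM x y : quot_pi (gs_mul S x y) = quot_mul (quot_pi x) (quot_pi y).
Proof.
apply/esym/quot_piE; apply: gs_relM; exact: repr_quot_pi.
Qed.

Lemma quot_piV x : quot_pi (gs_inv S x) = quot_inv (quot_pi x).
Proof. by apply/esym/quot_piE; apply: gs_relV; exact: repr_quot_pi. Qed.

Let quot_elim (P : quot_group -> Prop) : (forall x, P (quot_pi x)) -> forall q, P q.
Proof. by move=> Px q; have [x ->] := quot_pi_surj q. Qed.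

Fact quot_mulA : associative quot_mul.
Proof.
elim/quot_elim=> x; elim/quot_elim=> y; elim/quot_elim=> z.
by rewrite -!quot_piM; apply/quot_piE; exact: gs_mulA.
Qed.
Fact quot_mul1 : left_id (quot_pi (gs_one S)) quot_mul.
Proof.
by elim/quot_elim=> x; rewrite -quot_piM; apply/quot_piE; exact: gs_mul1.
Qed.
Fact quot_mulr1 : right_id (quot_pi (gs_one S)) quot_mul.
Proof.
by elim/quot_elim=> x; rewrite -quot_piM; apply/quot_piE; exact: gs_mulr1.
Qed.
Fact quot_mulV : left_inverse (quot_pi (gs_one S)) quot_inv quot_mul.
Proof.
elim/quot_elim=> x; rewrite -quot_piV -quot_piM; apply/quot_piE; exact: gs_mulV.
Qed.
Fact quot_mulrV : right_inverse (quot_pi (gs_one S)) quot_inv quot_mul.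
Proof.
elim/quot_elim=> x; rewrite -quot_piV -quot_piM; apply/quot_piE; exact: gs_mulrV.
Qed.

HB.instance Definition _ := isGroup.Build quot_group
  quot_mulA quot_mul1 quot_mulr1 quot_mulV quot_mulrV.

End QuotientGroup.

Section NormalQuotient.
Variables (F : groupType) (N : set F).
Hypothesis nN : normal_subgroup N.

Let coset_rel : rel F := fun x y => `[< N (x^-1 * y) >].

Fact coset_rel_equiv : equiv_class_of coset_rel.
Proof.
have [[N1 NM NV] NJ] := nN; split=> [x|x y|y x z].
- by apply/asboolP; rewrite mulVg.
- by apply/idP/idP=> /asboolP/NV; rewrite invgM invgK => ?; apply/asboolP.
- move=> /asboolP xy /asboolP yz; apply/asboolP.
  by have := NM _ _ xy yz; rewrite -mulgA mulVKg.
Qed.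

Fact coset_rel_M x x' y y' : coset_rel x x' -> coset_rel y y' ->
  coset_rel (x * y) (x' * y').
Proof.
have [[N1 NM NV] NJ] := nN => /asboolP xx' /asboolP yy'; apply/asboolP.
have := NM _ _ (NJ _ y xx') yy'.
by rewrite conjgE invgM !mulgA mulgK.
Qed.

Fact coset_rel_V x x' : coset_rel x x' -> coset_rel x^-1 x'^-1.
Proof.
have [[N1 NM NV] NJ] := nN => /asboolP xx'; apply/asboolP.
by have := NJ _ x^-1 (NV _ xx'); rewrite conjgE !invgM !invgK !mulgA mulgK.
Qed.

Let coset_rel_eq x y : x = y -> coset_rel x y.
Proof. by move=> ->; have [r _ _] := coset_rel_equiv; exact: r. Qed.

Definition coset_setoid : group_setoid F :=
  @GroupSetoid F mul 1 (fun x => x^-1) (EquivRelPack coset_rel_equiv)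
   coset_rel_M coset_rel_V
   (fun x y z => coset_rel_eq (mulgA x y z))
   (fun x => coset_rel_eq (mul1g x)) (fun x => coset_rel_eq (mulg1 x))
   (fun x => coset_rel_eq (mulVg x)) (fun x => coset_rel_eq (mulgV x)).

Lemma normal_quotient : exists (Q : groupType) (q : UMagmaMorphism.type F Q),
  (forall y, exists x, y = q x) /\ (forall x, q x = 1 <-> N x).
Proof.
pose q : F -> quot_group coset_setoid := @quot_pi F coset_setoid.
pose qM := isUMagmaMorphism.Build _ _ q (erefl, @quot_piM F coset_setoid).
pose qm : UMagmaMorphism.type _ _ := HB.pack q qM.
exists (quot_group coset_setoid), qm; split; first exact: quot_pi_surj.
have [[N1 NM NV] NJ] := nN.
move=> x; split.
  by move=> /quot_piE /asboolP; rewrite mulg1 => /NV; rewrite invgK.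
by move=> Nx; apply/quot_piE/asboolP; rewrite mulg1; exact: NV.
Qed.

End NormalQuotient.

(** * Free groups *)

Section FreeGroup.
Variable X : choiceType.

Definition word_eval (G : groupType) (f : X -> G) (w : seq (X * bool)) : G :=
  foldr (fun l => mul (if l.2 then f l.1 else (f l.1)^-1)) 1 w.

Let word_inv (w : seq (X * bool)) := rev [seq (l.1, ~~ l.2) | l <- w].

Lemma word_eval_cat (G : groupType) (f : X -> G) v w :
  word_eval f (v ++ w) = word_eval f v * word_eval f w.
Proof. by elim: v => /= [|l v ->]; rewrite ?mul1g ?mulgA. Qed.

Lemma word_eval_inv (G : groupType) (f : X -> G) w :
  word_eval f (word_inv w) = (word_eval f w)^-1.
Proof.
elim: w => [|l w IH]; first by rewrite invg1.
rewrite /word_inv /= rev_cons -cats1 word_eval_cat IH /= mulg1 invgM.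
by case: l.2; rewrite ?invgK.
Qed.

(** Two words are identified when no evaluation in a group distinguishes them.
    This yields the universal property without reduced words. *)
Let word_rel : rel (seq (X * bool)) := fun v w =>
  `[< forall (G : groupType) (f : X -> G), word_eval f v = word_eval f w >].

Fact word_rel_equiv : equiv_class_of word_rel.
Proof.
split=> [x|x y|y x z]; first exact/asboolP.
  by apply/idP/idP=> /asboolP xy; apply/asboolP=> G f.
by move=> /asboolP xy /asboolP yz; apply/asboolP=> G f; rewrite xy.
Qed.

Fact word_rel_M v v' w w' :
  word_rel v v' -> word_rel w w' -> word_rel (v ++ w) (v' ++ w').
Proof.
by move=> /asboolP vv' /asboolP ww'; apply/asboolP=> G f; rewrite !word_eval_cat vv' ww'.
Qed.

Fact word_rel_V v v' : word_rel v v' -> word_rel (word_inv v) (word_inv v').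
Proof.
by move=> /asboolP vv'; apply/asboolP=> G f; rewrite !word_eval_inv vv'.
Qed.

Definition word_setoid : group_setoid (seq (X * bool)).
Proof.
apply: (@GroupSetoid _ cat [::] word_inv (EquivRelPack word_rel_equiv)
  word_rel_M word_rel_V) => *; apply/asboolP=> G f;
  by rewrite !(word_eval_cat, word_eval_inv) /= ?mul1g ?mulg1 ?mulVg ?mulgV ?mulgA.
Defined.

Definition free_on := quot_group word_setoid.
HB.instance Definition _ := Group.on free_on.

Let free_pi (w : seq (X * bool)) : free_on := quot_pi word_setoid w.

Let free_piM v w : free_pi (v ++ w) = free_pi v * free_pi w.
Proof. exact: (quot_piM word_setoid). Qed.

Let free_piV w : free_pi (word_inv w) = (free_pi w)^-1.
Proof. exact: (quot_piV word_setoid). Qed.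

Definition free_gen (x : X) : free_on := free_pi [:: (x, true)].

Lemma free_on_ext (G : groupType) (h h' : UMagmaMorphism.type free_on G) :
  (forall x, h (free_gen x) = h' (free_gen x)) -> h =1 h'.
Proof.
move=> hh' q; have [w ->] := quot_pi_surj q; elim: w => [|[x b] w IH].
  by rewrite -[quot_pi _ _]/(1 : free_on) !gmulf1.
rewrite -[quot_pi _ _]/(free_pi ([:: (x, b)] ++ w)) free_piM !gmulfM IH.
congr (_ * _); case: b; first exact: hh'.
by rewrite -[free_pi _]/(free_pi (word_inv [:: (x, true)])) free_piV !gmulfV hh'.
Qed.

(** The second part says that the image of the lift is generated by the values
    of [f]. *)
Lemma free_on_lift (G : groupType) (f : X -> G) :
  exists h : UMagmaMorphism.type free_on G,
   (forall x, h (free_gen x) = f x) /\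
   (forall P : set G, subgroup P -> (forall x, P (f x)) -> forall u, P (h u)).
Proof.
pose h (u : free_on) := word_eval f (generic_quotient.repr (u : {eq_quot _})).
have hq w : h (free_pi w) = word_eval f w.
  by have /asboolP := repr_quot_pi word_setoid w; exact.
have h1 : h 1 = 1 by exact: (hq [::]).
have hM : {morph h : u v / u * v >-> u * v}.
  move=> u v; have [x ->] := quot_pi_surj u; have [y ->] := quot_pi_surj v.
  rewrite -[quot_pi _ x]/(free_pi x) -[quot_pi _ y]/(free_pi y).
  by rewrite -[_ * _]free_piM !hq word_eval_cat.
pose hm : UMagmaMorphism.type _ _ := HB.pack h (isUMagmaMorphism.Build _ _ h (h1, hM)).
exists hm; split=> [x|P [P1 PM PV] Pf u]; first by rewrite /hm /= hq /= mulg1.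
have [w ->] := quot_pi_surj u; rewrite /hm /= [h _]hq.
by elim: w => //= -[x []] w IH; apply: PM => //=; apply: PV.
Qed.

End FreeGroup.
Lemma free_on_gen (X : choiceType) (P : set (free_on X)) :
  subgroup P -> (forall x, P (free_gen x)) -> forall u, P u.
Proof.
move=> sP Pgen u; have [h [hgen hP]] := free_on_lift (@free_gen X).
suff <- : h u = u by exact: hP.
exact: (@free_on_ext X _ h idfun).
Qed.

Lemma free_on_free (X : choiceType) : free_group (free_on X).
Proof.
exists (range (@free_gen X)) => H f.
have [h [hgen _]] := free_on_lift (f \o @free_gen X).
exists h; split=> [_ [x _ <-]|h' h'gen]; first exact: hgen.
by apply: free_on_ext => x; rewrite hgen h'gen//; exists x.
Qed.

Lemma free_on_fg (X : finType) : finitely_generated (free_on X).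
Proof.
exists [seq free_gen x | x : X]; rewrite -subTset => u _ P [sP genP].
apply: free_on_gen sP _ u => x; apply: genP => /=.
by apply/mapP; exists x; rewrite ?mem_enum.
Qed.

(** The projection from the free group on the carrier of [F] that trivialises
    every letter outside [X] splits, by uniqueness, the homomorphism from [F]
    that sends a basis element to its letter.  So every element of [F] is the
    evaluation of a word whose letters are in [X]. *)
Lemma free_basis_generates (F : groupType) (X : set F) (P : set F) :
  free_basis X -> subgroup P -> X `<=` P -> forall u, P u.
Proof.
move=> fX sP XP u.
pose f x := if `[< X x >] then x else 1 : F.
have [h [hX _]] := fX _ (@free_gen F).
have [g [ggen gP]] := free_on_lift f.
have [k [_ kuniq]] := fX _ (idfun : F -> F).
have gh : g \o h =1 k.
  apply: (kuniq (g \o h)) => x Xx /=.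
  by rewrite hX// ggen /f; case: asboolP.
have -> : u = g (h u) by have := gh u; rewrite -(kuniq idfun).
apply: gP => // x; rewrite /f; case: asboolP; first exact: XP.
by case: sP.
Qed.

(** * Profinite closure and finite quotients *)

Section ProfiniteClosure.
Variable F : groupType.
Implicit Types (A K : set F) (gs : seq F).

Lemma profinite_closureP A w : profinite_closure A w <->
  forall K, normal_finite_index K -> exists2 u, A u & K (w^-1 * u).
Proof.
split=> [cAw K nK|AK B [K nK KB]].
  have [|u [Au [k Kk wku]]] := cAw (mul w @` K); first by exists K.
  by exists u => //; rewrite -wku mulKg.
have [u Au Kwu] := AK K nK; exists u; split=> //; apply: KB.
by exists (w^-1 * u) => //; rewrite mulVKg.
Qed.

Lemma not_profinite_closureP A w : ~ profinite_closure A w ->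
  exists2 K, normal_finite_index K & forall u, A u -> ~ K (w^-1 * u).
Proof.
move/profinite_closureP/existsNP => [K /not_implyP[nK AK]].
by exists K => // u Au Ku; apply: AK; exists u.
Qed.

(** Finitely many points, each outside the closure of its class product, are
    separated from these products in one common finite quotient. *)
Lemma finite_separation (L : seq (F * seq F)) :
  (forall p, p \in L -> ~ profinite_closure (class_prod p.2) p.1) ->
  exists2 K, normal_finite_index K &
    forall p u, p \in L -> class_prod p.2 u -> ~ K (p.1^-1 * u).
Proof.
elim: L => [|p L IH] nL; first by exists setT => //; exact: normal_finite_indexT.
have [|K nK KL] := IH; first by move=> r rL; apply: nL; rewrite inE rL orbT.
have [|K' nK' K'p] := not_profinite_closureP (nL p _); first exact: mem_head.
exists (K `&` K'); first exact: normal_finite_indexI.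
move=> r u; rewrite inE => /predU1P[-> /K'p|rL /(KL _ _ rL)] nK0 []//.
Qed.

Lemma normal_closure_normal A : normal_subgroup (normal_closure A).
Proof.
split=> [|x y Nx K [nK AK]].
  split=> [K [[[K1 _ _] _] _]//|x y Nx Ny K [nK AK]|x Nx K [nK AK]].
    by have [[_ KM _] _] := nK; apply: KM; [exact: Nx|exact: Ny].
  by have [[_ _ KV] _] := nK; apply: KV; exact: Nx.
by have [_ KJ] := nK; apply: KJ; exact: Nx.
Qed.

Section Kernel.
Variables (G : groupType) (h : UMagmaMorphism.type F G).

Lemma kernel_normal : normal_subgroup [set x | h x = 1].
Proof.
split; last by move=> x y /= hx; rewrite gmulfJ hx conj1g.
split=> [|x y /= hx hy|x /= hx] /=; first exact: gmulf1.
  by rewrite gmulfM hx hy mulg1.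
by rewrite gmulfV hx invg1.
Qed.

Lemma normal_closure_sub_kernel A :
  (forall x, A x -> h x = 1) -> forall x, normal_closure A x -> h x = 1.
Proof.
by move=> A1 x Nx; apply: (Nx [set y | h y = 1]); split; [exact: kernel_normal|].
Qed.

End Kernel.

Lemma kernel_finite_index (H : finGroupType) (h : UMagmaMorphism.type F H) :
  normal_finite_index [set x | h x = 1].
Proof.
split; first exact: kernel_normal.
apply: (@sub_finite_set _ _ ((fun b => [set y | h y = b]) @` [set: H])).
  move=> _ [x _ <-]; exists (h x) => //; apply/seteqP; split=> y /=.
    by move=> hyx; exists (x^-1 * y); rewrite ?mulVKg//= gmulfM gmulfV hyx mulVg.
  by move=> [z /= hz <-]; rewrite gmulfM hz mulg1.
by apply: finite_image; exact: finite_finset.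
Qed.

End ProfiniteClosure.

Section FiniteGroup.
Variables (Q : groupType) (s : seq Q) (sP : Finite.axiom s).

(** The carrier is kept, so that a homomorphism to [Q] is one to the finite
    group. *)
Definition enum_group (_ : Finite.axiom s) : Type := Q.
HB.instance Definition _ := Group.on (enum_group sP).
HB.instance Definition _ := isCountable.Build (enum_group sP)
  (@fin_pickleK Q s sP).
HB.instance Definition _ := isFinite.Build (enum_group sP) sP.
Definition enum_finGroup : finGroupType := enum_group sP.
End FiniteGroup.

(** The quotient is the image of the finite set of cosets of [K], sent to the
    class of any of their elements. *)
Lemma finite_quotient (F : groupType) (K : set F) : normal_finite_index K ->
  exists (H : finGroupType) (q : UMagmaMorphism.type F H),
  (forall y, exists x, y = q x) /\ (forall x, q x = 1 <-> K x).
Proof.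
move=> [nK fK]; have [Q [q [qsurj qK]]] := normal_quotient nK.
have : finite_set [set: Q].
  apply: sub_finite_set (finite_image (fun C => q (xget 1 C)) fK) => y _.
  have [x ->] := qsurj y; exists (mul x @` K); first by exists x.
  case: xgetP => [_ _ [k Kk <-]|/(_ x) []].
    by rewrite gmulfM (qK k).2 ?mulg1.
  by exists 1; rewrite ?mulg1//; case: nK => -[].
move=> /finite_seqP[s sT].
have sP : Finite.axiom (undup s).
  apply: Finite.uniq_enumP (undup_uniq _) _ => x; rewrite mem_undup.
  by have : [set: Q] x by []; rewrite sT.
by exists (enum_finGroup sP), q.
Qed.

(** * Bi-invariant metrics on finite groups *)

Section BiInvariantMetric.
Variables (R : realType) (H : finGroupType) (d : H -> H -> R).
Hypothesis dbi : bi_invariant_metric d.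
Local Open Scope ring_scope.

Lemma bim_mul x x' y y' : d (x * y)%g (x' * y')%g <= d x x' + d y y'.
Proof.
apply: (le_trans (bim_triangle dbi _ (x' * y)%g _)).
by rewrite (bim_invr dbi) (bim_invl dbi).
Qed.

Lemma bim_conj x y : d (x ^ y)%g 1%g = d x 1%g.
Proof.
rewrite -(bim_invr dbi y^-1%g) mul1g conjgE mulgA mulgK.
by rewrite -[X in d _ X]mulg1 (bim_invl dbi).
Qed.

(** Distances to 1 add up along a product and are invariant under conjugation. *)
Lemma bim_class_prod (F : groupType) (h : UMagmaMorphism.type F H) gs u :
  class_prod gs u -> d (h u) 1%g <= \sum_(g <- gs) d (h g) 1%g.
Proof.
elim: gs u => [|g gs IH] u /=; first by move=> ->; rewrite gmulf1 big_nil (bim_xx dbi).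
move=> [_ [y _ <-]] [v /IH hv <-]; rewrite big_cons gmulfM gmulfJ.
rewrite -[X in d _ X](mulg1 1%g); apply: le_trans (bim_mul _ _ _ _) _.
by rewrite bim_conj lerD2l.
Qed.
End BiInvariantMetric.

(** * A group that fails to be w-sofic *)

Section Tracking.
Variables (R : realType) (F Q : groupType) (q : UMagmaMorphism.type F Q).
Variable X : set F.
Local Open Scope ring_scope.

(** How far a homomorphism [h] that agrees with an approximate homomorphism on
    the basis [X] can drift from it at [u].  The set [Phi] and the constant [c]
    depend on [u] only: both have to be chosen before the finite group [H]. *)
Definition tracked (u : F) (Phi : set Q) (c : nat) : Prop :=
  [/\ finite_set Phi, Phi (q u) &
   forall (H : finGroupType) (d : H -> H -> R) (Psi : set Q) (eps alpha : R)
     (phi : Q -> H) (h : UMagmaMorphism.type F H),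
   bi_invariant_metric d -> approx_hom d Psi eps alpha phi -> Phi `<=` Psi ->
   (forall x, X x -> h x = phi (q x)) -> d (h u) (phi (q u)) <= c%:R * eps].

(** Each product or inversion costs one more [eps]; inverses reduce to products
    because [phi] maps 1 to 1. *)
Lemma tracked_subgroup : subgroup [set u | exists Phi c, tracked u Phi c].
Proof.
split=> [|u v [Phi [c [fPhi Phiu tu]]] [Phi' [c' [fPhi' Phiv tv]]]|
  u [Phi [c [fPhi Phiu tu]]]].
- exists [set 1%g], 0%N; split; [exact: finite_set1|exact: gmulf1|].
  move=> H d Psi eps alpha phi h dbi aphi sub _.
  by rewrite !gmulf1 (approx_hom1 aphi) ?(bim_xx dbi) ?mul0r//; apply: sub.
- exists ([set q (u * v)%g] `|` (Phi `|` Phi')), (c + c').+1; split.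
  + by rewrite !finite_setU; do !split=> //; exact: finite_set1.
  + by left.
  move=> H d Psi eps alpha phi h dbi aphi sub hX.
  apply: le_trans (bim_triangle dbi _ (phi (q u) * phi (q v))%g _) _.
  rewrite gmulfM -natr1 natrD !mulrDl mul1r; apply: lerD.
    apply: le_trans (bim_mul dbi _ _ _ _) _; apply: lerD.
      by apply: tu dbi aphi _ hX => x Phix; apply: sub; right; left.
    by apply: tv dbi aphi _ hX => x Phix; apply: sub; right; right.
  rewrite gmulfM; apply/ltW/(approx_homM aphi); first by apply: sub; right; left.
    by apply: sub; right; right.
  by apply: sub; left; rewrite /= gmulfM.
- exists ([set q u^-1%g; 1%g] `|` Phi), c.+1; split.
  + by rewrite !finite_setU; do !split=> //; exact: finite_set1.
  + by do 2 left.
  move=> H d Psi eps alpha phi h dbi aphi sub hX.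
  have Psi1 : Psi 1%g by apply: sub; left; right.
  rewrite -(bim_invl dbi (h u)) (gmulfV h) mulgV (bim_sym dbi).
  apply: le_trans (bim_triangle dbi _ (phi (q u) * phi (q u^-1))%g _) _.
  rewrite (bim_invr dbi) -natr1 mulrDl mul1r; apply: lerD.
    by apply: tu dbi aphi _ hX => x Phix; apply: sub; right.
  rewrite -(approx_hom1 aphi Psi1) -[in X in d _ X](mulgV (q u)) -gmulfV.
  apply/ltW/(approx_homM aphi); first by apply: sub; right.
    by apply: sub; left; left.
  by rewrite gmulfV mulgV.
Qed.

Lemma tracked_gen x : X x -> exists Phi c, tracked x Phi c.
Proof.
move=> Xx; exists [set q x], 0%N; split; [exact: finite_set1|by []|].
move=> H d Psi eps alpha phi h dbi aphi sub hX.
by rewrite hX// (bim_xx dbi) mul0r.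
Qed.
End Tracking.

(** [w] is a witness that [Q] separates from 1, but that every homomorphism from
    [F] to a finite group sends to a product of conjugates of the images of [gs],
    all of which [Q] trivialises. *)
Lemma quotient_not_w_sofic (R : realType) (F Q : groupType)
  (q : UMagmaMorphism.type F Q) (gs : seq F) (w : F) :
  free_group F -> profinite_closure (class_prod gs) w ->
  (forall g, g \in gs -> q g = 1) -> q w <> 1 -> ~ w_sofic R Q.
Proof.
move=> [X fX] wcl qgs qw [alpha alpha0 sofQ].
have allT u : exists p : set Q * nat, tracked R q X u p.1 p.2.
  have := free_basis_generates fX (tracked_subgroup R q X).
  by case/(_ (@tracked_gen _ _ _ q X) u) => Phi [c tu]; exists (Phi, c).
have [t tP] := choice allT.
(* [C.+1] makes [C%:R * eps] at most [alpha], also when [C] is 0. *)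
pose C := ((t w).2 + \sum_(g <- gs) (t g).2)%N.
pose eps := (alpha / (C.+1)%:R)%R.
have eps0 : (0 < eps)%R by rewrite divr_gt0.
have Phifin : finite_set (\bigcup_(u in [set` w :: gs]) (t u).1).
  by apply: bigcup_finite => // u _; have [] := tP u.
have [H [d [phi [dbi aphi]]]] := sofQ _ eps Phifin eps0.
have [h [hX _]] := fX H (phi \o q).
have htrack u : u \in w :: gs -> (d (h u) (phi (q u)) <= (t u).2%:R * eps)%R.
  move=> uws; have [_ _ tu] := tP u; apply: tu dbi aphi _ hX => x tux.
  by exists u.
have Phiq u : u \in w :: gs -> (\bigcup_(u in [set` w :: gs]) (t u).1) (q u).
  by move=> uws; exists u => //; have [] := tP u.
have hgs g : g \in gs -> (d (h g) 1%g <= (t g).2%:R * eps)%R.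
  move=> ggs; have gws : g \in w :: gs by rewrite inE ggs orbT.
  have := htrack _ gws; rewrite (qgs _ ggs) (approx_hom1 aphi)//.
  by rewrite -(qgs _ ggs); exact: Phiq.
have [u ugs hu] := (profinite_closureP _ _).1 wcl _ (kernel_finite_index h).
(* As [w] is in the closure, [h w] is the image of a point [u] of the product
   of the classes themselves. *)
have hwu : h w = h u.
  by move: hu => /=; rewrite gmulfM gmulfV => /mulg1_eq; rewrite invgK.
have := approx_hom_sep aphi (Phiq w (mem_head _ _)) qw; apply/negP; rewrite -leNgt.
apply: le_trans (bim_triangle dbi _ (h w) _) _.
rewrite (bim_sym dbi) {2}hwu.
apply: (@le_trans _ _ (C%:R * eps)%R); last first.
  by rewrite /eps mulrCA ger_pMr// ler_pdivrMr// mul1r ler_nat.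
rewrite natrD mulrDl; apply: lerD; first exact: htrack (mem_head _ _).
apply: le_trans (bim_class_prod dbi h ugs) _.
by rewrite natr_sum mulr_suml !big_seq; apply: ler_sum.
Qed.

(** * Word metrics *)

Section WordLength.
Variables (H : finGroupType) (A : {set H}) (n : nat).

(** The word length with respect to [A], truncated at [n]: [find] returns [n],
    the size of the list, on the elements outside the powers below [n]. *)
Definition word_length (x : H) : nat := find (fun k => x \in A ^+ k) (iota 0 n).

Lemma word_length_le k x : x \in A ^+ k -> word_length x <= k.
Proof.
move=> xAk; have [nk|kn] := leqP n k.
  by apply: leq_trans (find_size _ _) _; rewrite size_iota.
rewrite leqNgt; apply/negP => /(before_find 0).
by rewrite nth_iota// add0n xAk.
Qed.

Lemma word_length_max x : word_length x <= n.
Proof. by apply: leq_trans (find_size _ _) _; rewrite size_iota. Qed.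

Lemma word_length_in x : word_length x < n -> x \in A ^+ word_length x.
Proof.
move=> xn; have xh : has (fun k => x \in A ^+ k) (iota 0 n).
  by rewrite has_find size_iota.
by have := nth_find 0 xh; rewrite nth_iota.
Qed.

Lemma word_length1 : word_length 1 = 0.
Proof. by apply/eqP; rewrite -leqn0 word_length_le// expg0 set11. Qed.

Lemma word_length_eq0 x : 0 < n -> word_length x = 0 -> x = 1.
Proof.
move=> n0 x0; have := @word_length_in x.
by rewrite x0 => /(_ n0); rewrite expg0 => /set1P.
Qed.

Lemma word_lengthM x y : word_length (x * y) <= word_length x + word_length y.
Proof.
have [xn|xn] := ltnP (word_length x) n; last first.
  by apply: leq_trans (word_length_max _) (leq_trans xn (leq_addr _ _)).
have [yn|yn] := ltnP (word_length y) n; last first.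
  by apply: leq_trans (word_length_max _) (leq_trans yn (leq_addl _ _)).
by apply: word_length_le; rewrite expgnDr mem_mulg ?word_length_in.
Qed.

Lemma word_lengthV x : A^-1 = A -> word_length x^-1 = word_length x.
Proof.
move=> AV; apply: eq_find => k.
by rewrite -mem_invg -expVgn AV.
Qed.

Lemma word_lengthJ x y : A :^ y = A -> word_length (x ^ y) = word_length x.
Proof.
move=> AJ; apply: eq_find => k.
have AkJ : A ^+ k :^ y = A ^+ k.
  by elim: k => [|k IH]; [exact: conjs1g|rewrite expgS conjsMg IH AJ].
by rewrite -{1}AkJ memJ_conjg.
Qed.

Variables (R : realType) (c : R).
Local Open Scope ring_scope.

Definition word_dist (x y : H) : R := c * (word_length (x * y^-1)%g)%:R.

(** Left invariance of the distance is conjugation invariance of the length, as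
    [x * y^-1] is right invariant. *)
Lemma word_dist_bim : 0 < c -> (0 < n)%N -> (A^-1 = A)%g ->
  (forall y, A :^ y = A)%g -> bi_invariant_metric word_dist.
Proof.
move=> c0 n0 AV AJ; rewrite /word_dist; split=> [x|x y|x y|x y z|x a b|x a b].
- by rewrite mulgV word_length1 mulr0.
- move/eqP; rewrite mulf_eq0 gt_eqF//= pnatr_eq0 => /eqP/(word_length_eq0 n0).
  exact: divg1_eq.
- by rewrite -word_lengthV// invgM invgK.
- rewrite -mulrDr ler_pM2l// -natrD ler_nat.
  have -> : (x * z^-1 = (x * y^-1) * (y * z^-1))%g by rewrite mulgA mulgKV.
  exact: word_lengthM.
- by rewrite invgM mulgA -(word_lengthJ _ (AJ x)) conjgE !mulgA mulVg mul1g mulgKV.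
- by rewrite invgM !mulgA mulgK.
Qed.

End WordLength.

(** * Finite quotients of a presentation give approximations *)

Section Tuples.
Variable T : eqType.
Fixpoint words (s : seq T) (n : nat) : seq (seq T) :=
  if n is n'.+1 then [seq x :: t | x <- s, t <- words s n'] else [:: [::]].

Lemma words_size (s : seq T) n t : t \in words s n -> size t = n.
Proof.
elim: n t => [|n IH] t /=; first by rewrite inE => /eqP->.
by case/allpairsP=> -[x u] /= [_ /IH <- ->].
Qed.

Lemma words_sub (s : seq T) n t : t \in words s n -> {subset t <= s}.
Proof.
elim: n t => [|n IH] t /=; first by rewrite inE => /eqP->.
move=> /allpairsP[[x u] /= [xs /IH us ->]] y; rewrite inE => /predU1P[->//|].
exact: us.
Qed.
End Tuples.

Section ConjugateBall.
Variables (F : groupType) (H : finGroupType) (q : UMagmaMorphism.type F H).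
Variable rels : seq F.
Hypothesis qsurj : forall y, exists x, y = q x.

Definition conj_ball : {set H} :=
  [set h : H | `[< exists2 r, r \in rels & exists y, h = q (r ^ y) >]].

Lemma conj_ballP h :
  reflect (exists2 r, r \in rels & exists y, h = q (r ^ y)) (h \in conj_ball).
Proof. by rewrite inE; exact: asboolP. Qed.

Lemma conj_ballJ y : conj_ball :^ y = conj_ball.
Proof.
have sub z : conj_ball :^ z \subset conj_ball.
  apply/fintype.subsetP => _ /imsetP[h /conj_ballP[r rr [x ->]] ->].
  have [v ->] := qsurj z.
  by apply/conj_ballP; exists r => //; exists (x * v); rewrite -gmulfJ conjgM.
apply/eqP; rewrite finset.eqEsubset sub/=.
by have := sub y^-1; rewrite -(conjSg _ _ y) conjsgKV.
Qed.

Lemma conj_ballV : {in rels, forall r, r^-1 \in rels} -> conj_ball^-1 = conj_ball.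
Proof.
move=> relsV; have sub : conj_ball^-1 \subset conj_ball.
  apply/fintype.subsetP => h; rewrite mem_invg => /conj_ballP[r rr [y hy]].
  apply/conj_ballP; exists r^-1; first exact: relsV.
  by exists y; rewrite conjVg gmulfV -hy invgK.
by apply/eqP; rewrite finset.eqEsubset sub/= -invSg invgK.
Qed.

(** Conjugators lift along [q], so a product of elements of the ball comes from
    a class product of [F] of the same length. *)
Lemma conj_ball_exp n h : h \in conj_ball ^+ n ->
  exists2 t, t \in words rels n & exists2 u, class_prod t u & h = q u.
Proof.
elim: n h => [|n IH] h.
  rewrite expg0 => /set1P ->; exists [::]; first by rewrite inE.
  by exists 1; last rewrite gmulf1.
rewrite expgS => /mulsgP[x z /conj_ballP[r rr [y ->]] /IH[t tn [u tu ->]] ->].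
exists (r :: t); first by apply/allpairsP; exists (r, t).
exists (r ^ y * u); last by rewrite [RHS]gmulfM.
by exists (r ^ y); [exists y|exists u].
Qed.
End ConjugateBall.

Section Presentation.
Variables (G : groupType) (s : seq G).

Let X := seq_sub [seq a <- s | a != 1].

(** The unit is not a generator: an approximate homomorphism has to send it to
    exactly 1. *)
Definition table_gen (a : G) : free_on X :=
  if insub a is Some x then free_gen x else 1.

Definition table_rels : seq (free_on X) :=
  [seq table_gen p.1 * table_gen p.2 * (table_gen (p.1 * p.2))^-1 |
    p <- [seq (a, b) | a <- s, b <- s] & p.1 * p.2 \in s].

Lemma table_gen1 : table_gen 1 = 1.
Proof. by rewrite /table_gen insubF// mem_filter eqxx. Qed.

Lemma table_eval : exists2 h : UMagmaMorphism.type (free_on X) G,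
  {in s, forall a, h (table_gen a) = a} & {in table_rels, forall r, h r = 1}.
Proof.
have [h [hgen _]] := free_on_lift (fun x : X => ssval x).
have hg : {in s, forall a, h (table_gen a) = a}.
  move=> a sa; rewrite /table_gen; case: insubP => [x _ <-|]; first exact: hgen.
  by rewrite mem_filter sa andbT negbK => /eqP ->; rewrite gmulf1.
exists h => // _ /mapP[p + ->]; rewrite mem_filter => /andP[ps].
case/allpairsP=> -[a b] /= [sa sb pab]; move: ps; rewrite pab /= => sab.
by rewrite !gmulfM gmulfV !hg// mulgV.
Qed.
End Presentation.

(** The separation constant 1 serves for all groups, since the metrics can be
    rescaled. *)
Lemma closed_class_prods_w_sofic (R : realType) :
  (forall (F : groupType) (gs : seq F), finitely_generated F -> free_group F ->
    0 < size gs -> profinite_closure (class_prod gs) `<=` normal_closure [set` gs]) ->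
  forall G : groupType, w_sofic R G.
Proof.
move=> closedN G; exists 1%R => // Phi eps /finite_seqP[s ->] eps0.
pose gen := table_gen s.
(* Inverses make the ball symmetric; 1 makes its powers increase, so that words
   of length exactly [n] account for the shorter ones. *)
pose rels : seq (free_on _) := 1 :: table_rels s ++ [seq r^-1 | r <- table_rels s].
(* With step [eps / 2], truncation at [n] gives diameter above 1. *)
pose n := (Num.bound (2 / eps)%R).+1.
have [ev evg evr] := table_eval s.
have evrels : {in rels, forall r, ev r = 1}.
  move=> r; rewrite inE mem_cat => /or3P[/eqP->|/evr//|/mapP[v /evr vr ->]].
    by rewrite gmulf1.
  by rewrite gmulfV vr invg1.
have relsV : {in rels, forall r, r^-1 \in rels}.
  move=> r; rewrite !inE !mem_cat => /or3P[/eqP->|rr|/mapP[v vr ->]].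
  - by rewrite invg1 eqxx.
  - by rewrite (map_f (fun r => r^-1) rr) !orbT.
  - by rewrite invgK vr orbT.
pose L := [seq (gen a, t) | a <- [seq a <- s | a != 1], t <- words rels n].
(* A generator [a] in a closure would, by hypothesis, be in the normal closure of
   relators that [ev] kills, whereas [ev] maps it to [a <> 1]. *)
have [|K nK KL] := @finite_separation _ L.
  move=> _ /allpairsP[[a t] [+ tn ->]]; rewrite [_.1]/= mem_filter => /andP[/eqP a1 sa].
  move/(closedN _ t (free_on_fg _) (free_on_free _)); rewrite (words_size tn).
  move=> /(_ isT)/(normal_closure_sub_kernel (h := ev)) gena; apply: a1.
  rewrite -(evg _ sa); apply: gena => g gt; apply: evrels.
  exact: words_sub tn _ gt.
have [H [q [qsurj qK]]] := finite_quotient nK.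
pose A := conj_ball q rels.
have A1 : 1 \in A.
  by apply/conj_ballP; exists 1; [exact: mem_head|exists 1; rewrite conj1g gmulf1].
have expA k : k <= n -> A ^+ k \subset A ^+ n.
  move=> kn; rewrite -(subnK kn) expgnDr mulg_subr//.
  by elim: (n - k)%N => [|m IH]; rewrite ?expg0 ?set11// expgS -(mulg1 1) mem_mulg.
exists H, (word_dist A n (eps / 2)%R), (q \o gen); split.
  apply: word_dist_bim => //; first by rewrite divr_gt0.
    exact: conj_ballV.
  exact: conj_ballJ.
split=> [a b sa sb sab|_|a sa a1] /=.
- rewrite /word_dist -gmulfV -!gmulfM.
  have : q (gen a * gen b * (gen (a * b))^-1) \in A ^+ 1.
    rewrite expg1; apply/conj_ballP; eexists; last by exists 1; rewrite conjg1.
    rewrite inE mem_cat; apply/or3P/Or32/mapP; exists (a, b) => //.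
    by rewrite mem_filter /= sab allpairs_f.
  move=> /(word_length_le n) len; apply: (@le_lt_trans _ _ (eps / 2)%R).
    by rewrite ger_pMr ?divr_gt0// lern1.
  by rewrite ltr_pdivrMr// ltr_pMr// ltr1n.
- by rewrite /gen table_gen1 gmulf1.
- rewrite /word_dist invg1 mulg1.
  suff -> : word_length A n (q (gen a)) = n.
    rewrite mulrC -ltr_pdivrMr ?divr_gt0// mul1r invf_div.
    apply: lt_trans (archi_boundP _) _; first by rewrite divr_ge0// ltW.
    by rewrite ltr_nat.
  apply/eqP; rewrite eqn_leq word_length_max leqNgt; apply/negP => lenn.
  have /(fintype.subsetP (expA _ (ltnW lenn))) := word_length_in lenn.
  move=> /conj_ball_exp[t tn [u tu qu]].
  apply: (KL (gen a, t) u) => //=.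
    by apply: allpairs_f => //; rewrite mem_filter sa andbT; apply/eqP.
  by apply/qK; rewrite gmulfM gmulfV qu mulVg.
Qed.

Theorem corollary4p6 (R : realType) :
  (exists G : groupType, ~ w_sofic R G) <->
  (exists (F : groupType) (gs : seq F),
     [/\ finitely_generated F, free_group F, (0 < size gs)%N &
         ~ (profinite_closure (class_prod gs) `<=` normal_closure [set` gs])]).
Proof.
split=> [[G nG]|[F [gs [_ freeF _ /existsNP[w /not_implyP[wcl wN]]]]]].
  apply: contrapT => noF; apply: nG; apply: closed_class_prods_w_sofic.
  move=> F gs fgF freeF gs0; apply: contrapT => nsub.
  by apply: noF; exists F, gs.
have [Q [q [_ qN]]] := normal_quotient (normal_closure_normal [set` gs]).
exists Q; apply: (quotient_not_w_sofic (q := q) freeF wcl); last by move/qN.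
by move=> g ggs; apply/qN => K [_]; apply.
Qed.
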